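(* Let $(p_i)_{i\in\mathbb{N}}$ be a sequence in $[0,1]$ with $\limsup_{i\to\infty} p_i>0$. Then for all $p\in(0,1)$, $\varepsilon\in(0,1]$ and $\alpha>0$, there exists $K=K(p,\varepsilon,(p_i),\alpha)\in\mathbb{N}$ large enough such that $$\mathbb{P}^{K}_{p,\varepsilon}\left(W_0=\Xi\right)>1-\alpha .$$
   Context: Graph: the vertex set is $\mathbb{Z}^2$. Let $\mathcal{E}_V$ be the set of vertical edges $\{(x,y_1),(x,y_2)\}$ with $|y_1-y_2|=1$; for $i\in\mathbb{N}=\{1,2,\dots\}$ let $\mathcal{E}_{H,i}$ be the set of horizontal edges $\{(x_1,y),(x_2,y)\}$ with $|x_1-x_2|=i$. Put $\mathcal{E}=\mathcal{E}_V\cup\bigcup_{i\ge1}\mathcal{E}_{H,i}$. Measure: for $K\in\mathbb{N}$, $p\in(0,1)$, $\varepsilon\in(0,1]$ and a sequence $(p_i)$ in $[0,1]$, $\mathbb{P}^K_{p,\varepsilon}$ is the law of a pair $(\omega,\eta)\in\{0,1\}^{\mathcal{E}}\times\{0,1\}^{\mathbb{Z}^2}$ with all coordinates independent, where $\omega(e)=1$ ($e$ is open) with probability $\varepsilon$ if $e\in\mathcal{E}_V$, with probability $p_i$ if $e\in\mathcal{E}_{H,i}$ with $i\leq K$, and with probability $0$ if $e\in\mathcal{E}_{H,i}$ with $i>K$; and $\eta(v)=1$ with probability $p$, $\eta(v)=0$ with probability $1-p$, for each $v\in\mathbb{Z}^2$. Words: $\Xi=\{0,1\}^{\mathbb{N}}$;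 its elements $\xi=(\xi_1,\xi_2,\dots)$ are called words. A word $\xi$ is seen from $v\in\mathbb{Z}^2$ in $(\omega,\eta)$ if there is a sequence $v=v_0,v_1,v_2,\dots$ of pairwise distinct vertices of $\mathbb{Z}^2$ such that for all $i\geq1$: $\{v_{i-1},v_i\}\in\mathcal{E}$ has length at most $K$, $\omega(\{v_{i-1},v_i\})=1$, and $\eta(v_i)=\xi_i$ (the state of $v_0$ plays no role). $W_0$ denotes the (random) set of words seen from the origin $(0,0)$. *)

(* Defs.v *)
From mathcomp Require Import all_boot all_order all_algebra finmap.
From mathcomp Require Import all_classical all_reals all_analysis.

Set Implicit Arguments.
Unset Strict Implicit.
Unset Printing Implicit Defensive.

Import Order.TTheory GRing.Theory Num.Theory.

Local Open Scope classical_set_scope.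
Local Open Scope ring_scope.

Notation vertex := (int * int)%type.

Definition origin : vertex := (0, 0).

Definition vertical_edges : set {fset vertex} :=
  [set e | exists x y1 y2 : int,
     `|y1 - y2| = 1 /\ e = [fset (x, y1); (x, y2)]%fset].

Definition horizontal_edges (i : nat) : set {fset vertex} :=
  [set e | exists x1 x2 y : int,
     `|x1 - x2| = i%:Z /\ e = [fset (x1, y); (x2, y)]%fset].

Definition edges : set {fset vertex} :=
  vertical_edges `|` \bigcup_(i in [set i | (1 <= i)%N]) horizontal_edges i.

(* On the end points of an edge, which is parallel to an axis, the l^1 distance
   is the length of the edge. *)
Definition dist (u v : vertex) : nat := (`|u.1 - v.1| + `|u.2 - v.2|)%N.

Definition is_open (w : edges -> bool) (u v : vertex) : Prop :=
  exists2 e : edges, val e = [fset u; v]%fset & w e = true.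

(* Words are indexed from 0: [xi i] is the letter of index [i.+1] in the usual
   numbering from 1, read at the [i.+1]-st vertex of the path. *)
Definition word : Type := nat -> bool.

Definition seen (K : nat) (w : edges -> bool) (h : vertex -> bool)
    (x : vertex) (xi : word) : Prop :=
  exists v : nat -> vertex,
    [/\ v 0%N = x, injective v
      & forall i, [/\ (dist (v i) (v i.+1) <= K)%N,
                      is_open w (v i) (v i.+1)
                    & h (v i.+1) = xi i]].

(* W_0 *)
Definition words_seen (K : nat) (w : edges -> bool) (h : vertex -> bool) :
    set word :=
  [set xi | seen K w h origin xi].

Definition mutually_independent d (T : measurableType d) (R : realType)
    (P : probability T R) d' (T' : measurableType d') (I : choiceType)
    (X : I -> {RV P >-> T'}) : Prop :=
  forall (J : {fset I}) (B : I -> set T'), (forall j, measurable (B j)) ->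
    P (\bigcap_(j in [set` J]) (X j @^-1` B j))
    = (\prod_(j <- J) P (X j @^-1` B j))%E.

(* The random configuration (omega, eta), defined on (T, P), has the law
   P^K_{p, eps}, for horizontal edge densities [q i], i >= 1; the value [q 0]
   is not used. *)
Definition percolation_model (R : realType) (K : nat) (p eps : R)
    (q : nat -> R) d (T : measurableType d) (P : probability T R)
    (omega : edges -> {RV P >-> bool}) (eta : vertex -> {RV P >-> bool}) :
    Prop :=
  [/\ mutually_independent (fun j : edges + vertex =>
        match j with inl e => omega e | inr v => eta v end),
      forall e : edges, vertical_edges (val e) ->
        P (omega e @^-1` [set true]) = eps%:E,
      forall (e : edges) (i : nat), (1 <= i)%N -> horizontal_edges i (val e) ->
        P (omega e @^-1` [set true]) = (if (i <= K)%N then q i else 0)%:E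
    & forall v : vertex, P (eta v @^-1` [set true]) = p%:E].

(* Main.v *)
Require Import Defs.
From mathcomp Require Import all_boot all_order all_algebra finmap.
From mathcomp Require Import all_classical all_reals all_analysis.
From mathcomp Require Import lra zify.

(** Infinitely many lengths [i] have density at least some [delta > 0].  Choosing
   [K] large makes arbitrarily many of them available, and many independent
   attempts of fixed positive probability turn a possible connection into an
   almost sure one.

   Renormalization.  Pick a superincreasing finite family of such lengths: [f a]
   (candidates), [l x] (lanes) and the largest one, [L], which serves as [K].
   The site [(i, t)] of a macroscopic quarter plane stands for the row [t] around
   abscissa [i * L]; the points [i * L + f a] are the possible entries to the
   site.  From an entry of a site to an entry of a neighbouring site there is,
   for each lane, a route of five edges,
     [f a -> f a + l x -> l x -> (next site) l x -> l x + f b -> f b],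
   whose four inner vertices belong to this lane only.  Five edges are used
   whatever the two entries are, so the letter that the new entry must carry is
   known in advance.  A site is good if entries of both labels exist in it and
   if, whatever the two entries and the four inner letters, some lane of each of
   its two outgoing macroscopic edges is open and reads these letters.  Goodness
   does not depend on the word, fails with arbitrarily small probability
   ([prob_bad_site]), and is independent from site to site, since lanes and
   entries of distinct sites are disjoint.  A self-avoiding path of good sites
   can be followed while reading any word whatsoever ([word_along_path]).

   Macroscopic percolation.  A box of scale [k + 1] is made
   of nine boxes of scale [k] and is declared bad if two of them are bad.  Then the
   probability of being bad is at most [81] times its square at the previous
   scale, hence summable over the scales ([prob_bad_box]).  When all the boxes at
   the origin are good, the origin is joined to sites arbitrarily far away: a 3 x 3
   grid deprived of one cell is connected, and two adjacent good boxes still face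
   each other through a pair of good sub-boxes ([good_boxes_long_path]).

   So with probability close to [1] all finite words are seen from the origin.  The
   graph being locally finite, Koenig's lemma ([seen_koenig]) gives all infinite
   words, and shows that the event is a countable combination of elementary
   events, hence measurable ([measurable_all_words]). *)

Set Implicit Arguments.
Unset Strict Implicit.
Unset Printing Implicit Defensive.

Import Order.TTheory GRing.Theory Num.Theory.

(** * Hierarchical boxes on the macroscopic lattice *)

Notation site := (nat * nat)%type.

Definition forward (d : bool) (s : site) : site :=
  if d then (s.1.+1, s.2) else (s.1, s.2.+1).

Definition subbox (B : site) (p : 'I_3 * 'I_3) : site :=
  (3 * B.1 + p.1, 3 * B.2 + p.2).

(** A good box tolerates one bad sub-box: two simultaneous defects have a squared
   probability, and one defect does not disconnect a 3 x 3 grid. *)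
Fixpoint bad_box (bad : pred site) (k : nat) (B : site) : bool :=
  if k is k'.+1 then
    [exists pp : ('I_3 * 'I_3) * ('I_3 * 'I_3),
      [&& pp.1 != pp.2, bad_box bad k' (subbox B pp.1)
        & bad_box bad k' (subbox B pp.2)]]
  else bad B.

Definition good_adjacent (bad : pred site) : rel site := fun s s' =>
  [&& ~~ bad s, ~~ bad s'
    & [exists d, (s' == forward d s) || (s == forward d s')]].

(** A bad cell in the centre leaves the ring of the eight others; a bad cell on the
   ring leaves a path, and the centre touches it.  The connectivity relation
   enters through a colouring [h] that is constant along good neighbours: [h] is
   then constant on all good cells. *)
Lemma grid3_connected (g h : nat -> nat -> bool) :
  (forall a b a' b', a < 3 -> b < 3 -> a' < 3 -> b' < 3 ->
     (a, b) != (a', b') -> g a b || g a' b') ->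
  (forall a b, a < 2 -> b < 3 -> g a b -> g a.+1 b -> h a b = h a.+1 b) ->
  (forall a b, a < 3 -> b < 2 -> g a b -> g a b.+1 -> h a b = h a b.+1) ->
  forall a b a' b', a < 3 -> b < 3 -> a' < 3 -> b' < 3 ->
  g a b -> g a' b' -> h a b -> h a' b'.
Proof.
move=> one hor ver a b a' b' a3 b3 a'3 b'3 gab ga'b' hab.
have [/forallP allg|] := boolP [forall p : 'I_3 * 'I_3, g p.1 p.2].
  have G x y (x3 : x < 3) (y3 : y < 3) : g x y
    by exact: (allg (Ordinal x3, Ordinal y3)).
  have H x y : x < 3 -> y < 3 -> h x y = h 0 0.
    move=> x3 y3; have -> : h x y = h 0 y.
      elim: x x3 => // x IH x3.
      rewrite -hor ?G //; first by apply: IH; lia.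
      lia.
    elim: y y3 => // y IH y3; rewrite -ver ?G //; last lia.
    by apply: IH; lia.
  by rewrite H // -(H a b).
rewrite negb_forall => /existsP[[[x x3] [y y3]] /= gxy].
have G u v : u < 3 -> v < 3 -> (u, v) != (x, y) -> g u v.
  by move=> u3 v3 ne; have := one _ _ _ _ u3 v3 x3 y3 ne;
    rewrite (negbTE gxy) orbF.
have nab : (a, b) != (x, y) by apply: contraNneq gxy => -[<- <-].
have na'b' : (a', b') != (x, y) by apply: contraNneq gxy => -[<- <-].
have hor' u v : u < 2 -> v < 3 -> (u, v) != (x, y) -> (u.+1, v) != (x, y) ->
    h u v = h u.+1 v.
  by move=> u2 v3 ? ?; apply: hor => //; apply: G => //; lia.
have ver' u v : u < 3 -> v < 2 -> (u, v) != (x, y) -> (u, v.+1) != (x, y) ->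
    h u v = h u v.+1.
  by move=> u2 v3 ? ?; apply: ver => //; apply: G => //; lia.
have H u v : u < 3 -> v < 3 -> (u, v) != (x, y) ->
    h u v = if (x, y) == (0, 0) then h 2 2 else h 0 0.
  move: (hor' 0 0) (hor' 1 0) (hor' 0 1) (hor' 1 1) (hor' 0 2) (hor' 1 2).
  move: (ver' 0 0) (ver' 0 1) (ver' 1 0) (ver' 1 1) (ver' 2 0) (ver' 2 1).
  move: x y {gxy hor' ver' G nab na'b'} x3 y3.
  do 3?[case=> [|]] => //; do 3?[case=> [|]] => // _ _; move: u v;
    do 3?[case=> [|]] => //; do 3?[case=> [|]] => //;
    do 12?[move/(_ isT isT isT isT)=> ? || move=> _]; move=> * /=; congruence.
by rewrite H // -(H a b).
Qed.

Section Boxes.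
Variable bad : pred site.
Local Notation badk := (bad_box bad).
Local Notation adj := (good_adjacent bad).

Definition joined (s s' : site) : Prop :=
  exists2 p, path adj s p & last s p = s'.

Lemma good_adjacent_sym s s' : adj s s' = adj s' s.
Proof.
rewrite /good_adjacent andbCA; congr [&& _, _ & _].
by apply: eq_existsb => d; rewrite orbC.
Qed.

Lemma joined_refl s : joined s s. Proof. by exists [::]. Qed.

Lemma joined_trans s1 s2 s3 : joined s1 s2 -> joined s2 s3 -> joined s1 s3.
Proof.
move=> [p pp <-] [p' pp' <-]; exists (p ++ p'); first by rewrite cat_path pp.
by rewrite last_cat.
Qed.

Lemma joined_sym s s' : joined s s' -> joined s' s.
Proof.
move=> [p pp <-]; exists (rev (belast s p)); last first.
  by case: p pp => //= x p _; rewrite rev_cons last_rcons.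
by rewrite rev_path (eq_path (e' := adj)) // => x y; rewrite good_adjacent_sym.
Qed.

Lemma good_subboxes k B p p' :
  ~~ badk k.+1 B -> p != p' ->
  ~~ badk k (subbox B p) || ~~ badk k (subbox B p').
Proof.
move=> /= /existsPn/(_ (p, p')) /= H ne; move: H.
by rewrite ne /= negb_and.
Qed.

Definition cell (a b : nat) : 'I_3 * 'I_3 := (inord a, inord b).

Lemma cell_neq a b a' b' : a < 3 -> b < 3 -> a' < 3 -> b' < 3 ->
  (a, b) != (a', b') -> cell a b != cell a' b'.
Proof.
move=> a3 b3 a'3 b'3; apply: contraNneq => -[].
by move=> /(congr1 val) + /(congr1 val); rewrite /= !inordK // => -> ->.
Qed.

Lemma cellE (p : 'I_3 * 'I_3) : p = cell p.1 p.2.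
Proof. by case: p => i j; rewrite /cell !inord_val. Qed.

(** In a good box, these sites all belong to one cluster, whereas the other good
   sites of the box may be isolated. *)
Fixpoint core (k : nat) (B : site) (s : site) : Prop :=
  if k is k'.+1 then
    exists2 p, ~~ badk k' (subbox B p) & core k' (subbox B p) s
  else s = B.

Lemma core_nonempty k B : ~~ badk k B -> exists s, core k B s.
Proof.
elim: k B => [|k IH] B gB; first by exists B.
have ne : cell 0 0 != cell 0 1 by apply: cell_neq.
have /orP[g|g] := good_subboxes gB ne.
- by have [s cs] := IH _ g; exists s; exists (cell 0 0).
- by have [s cs] := IH _ g; exists s; exists (cell 0 1).
Qed.

(** Induction on the scale.  Within a box, the good sub-boxes are connected as cells
   of a 3 x 3 grid; across the common side of two boxes, one good pair of facing
   sub-boxes makes the junction. *)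
Lemma core_joined k B B' s s' :
  ~~ badk k B -> ~~ badk k B' -> B' = B \/ (exists d, B' = forward d B) ->
  core k B s -> core k B' s' -> joined s s'.
Proof.
elim: k B B' s s' => [|k IH] B B' s s'.
  move=> /= gB gB' BB' -> ->; case: BB' => [->|[d BB']]; first exact: joined_refl.
  exists [:: B'] => //=; rewrite andbT /good_adjacent gB gB' /=.
  by apply/existsP; exists d; rewrite BB' eqxx.
have same C t t' : ~~ badk k.+1 C -> core k.+1 C t -> core k.+1 C t' ->
    joined t t'.
  move=> gC [p gp ct] [p' gp' ct'].
  pose g a b := ~~ badk k (subbox C (cell a b)).
    (* Colour a cell by whether its whole core is joined to [t]. *)
pose h a b := `[< forall u, core k (subbox C (cell a b)) u -> joined t u >].
  have step d a b a' b' : g a b -> g a' b' ->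
      subbox C (cell a' b') = forward d (subbox C (cell a b)) -> h a b = h a' b'.
    move=> gab ga'b' sn; apply/asboolP/asboolP => H u cu.
      have [v cv] := core_nonempty gab.
      apply: joined_trans (H _ cv) _; apply: (IH _ _ _ _ gab ga'b') cv cu.
      by right; exists d.
    have [v cv] := core_nonempty ga'b'.
    apply: joined_trans (H _ cv) _; apply: joined_sym.
    by apply: (IH _ _ _ _ gab ga'b') cu cv; right; exists d.
  rewrite (cellE p) in gp ct; rewrite (cellE p') in gp' ct'.
  suff /asboolP H : h p'.1 p'.2 by exact: H.
  apply: (@grid3_connected g h _ _ _ p.1 p.2) => //.
  - move=> a b a' b' a3 b3 a'3 b'3 ne.
    by apply: good_subboxes => //; apply: cell_neq.
  - move=> a b a2 b3 gab ga'b; apply: (step true) => //.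
    rewrite /subbox /forward /= !inordK //; last by rewrite ltnW.
    by rewrite addnS.
  - move=> a b a2 b3 gab ga'b; apply: (step false) => //.
    rewrite /subbox /forward /= !inordK //; last by rewrite ltnW.
    by rewrite addnS.
  - by apply/asboolP => u cu; apply: (IH _ _ _ _ gp gp) ct cu; left.
move=> gB gB' [->|[d BB']] cs cs'; first exact: same cs cs'.
(* Three pairs of cells face each other across the common side, and each box
   spoils at most one pair. *)
pose p i := if d then cell 2 i else cell i 2.
pose p' i := if d then cell 0 i else cell i 0.
have pne i j : i < 3 -> j < 3 -> i != j -> (p i != p j) && (p' i != p' j).
  move=> i3 j3 ij; rewrite /p /p'.
  by case: (d); rewrite !cell_neq // xpair_eqE ?eqxx ?andbT.
have [i i3 [gi gi']] : exists2 i, i < 3 &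
    ~~ badk k (subbox B (p i)) /\ ~~ badk k (subbox B' (p' i)).
  have gg i j : i < 3 -> j < 3 -> i != j -> _ /\ _ := fun i3 j3 ij =>
    let: conj e e' := andP (pne i j i3 j3 ij) in
    conj (good_subboxes gB e) (good_subboxes gB' e').
  have [/orP h01 /orP h01'] := gg 0 1 isT isT isT.
  have [/orP h02 /orP h02'] := gg 0 2 isT isT isT.
  have [/orP h12 /orP h12'] := gg 1 2 isT isT isT.
  case: (boolP (badk k (subbox B (p 0)))) h01 h02 h12 => b0 h01 h02 h12;
  case: (boolP (badk k (subbox B (p 1)))) h01 h02 h12 => b1 h01 h02 h12;
  case: (boolP (badk k (subbox B' (p' 0)))) h01' h02' h12' => b0' h01' h02' h12';
  case: (boolP (badk k (subbox B' (p' 1)))) h01' h02' h12' => b1' h01' h02' h12';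
  by [exists 0 | exists 1 | exists 2; [|split]; intuition].
have [v cv] := core_nonempty gi; have [v' cv'] := core_nonempty gi'.
have jv : joined s v by apply: same cs _ => //; exists (p i).
have jv' : joined v' s' by apply: same cs' => //; exists (p' i).
apply: joined_trans jv (joined_trans _ jv').
apply: (IH _ _ _ _ gi gi') cv cv'; right; exists d.
rewrite BB' /p /p' /subbox /forward; case: (d) => /=; rewrite !inordK //;
  congr pair; lia.
Qed.

Lemma core_far k B s : core k B s -> 3 ^ k * B.1 <= s.1.
Proof.
elim: k B => [|k IH] B /=; first by move->; rewrite mul1n.
case=> p _ /IH /=; apply: leq_trans.
by rewrite expnSr -mulnA leq_mul2l leq_addr orbT.
Qed.

Lemma core_origin k :
  (forall k, ~~ badk k (0, 0)) -> core k (0, 0) (0, 0).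
Proof.
move=> good; elim: k => [|k IH] //=; exists (cell 0 0);
  by rewrite /subbox /= !inordK.
Qed.

Lemma good_adjacent_step s s' : adj s s' -> s'.1 <= s.1.+1.
Proof.
case/and3P => _ _ /existsP[d /orP[]/eqP ->]; rewrite /forward;
  case: d => //=; lia.
Qed.

(** A good box of scale [N + 1] has a good sub-box in its last column, whose core
   lies at distance at least [3 ^ N] from the origin; a path to it, once made
   self-avoiding, has at least [N] steps. *)
Lemma good_boxes_long_path N :
  (forall k, ~~ badk k (0, 0)) ->
  exists p, [/\ path adj (0, 0) p, uniq ((0, 0) :: p) & N <= size p].
Proof.
move=> good.
have [s [Ns cs]] : exists s, N <= s.1 /\ core N.+1 (0, 0) s.
  have ne : cell 2 0 != cell 2 1 by apply: cell_neq.
  have far i : i < 3 -> ~~ badk N (subbox (0, 0) (cell 2 i)) ->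
      exists s, N <= s.1 /\ core N.+1 (0, 0) s.
    move=> i3 gi; have [s cs] := core_nonempty gi.
    exists s; split; last by exists (cell 2 i).
    apply: leq_trans (core_far cs); rewrite /subbox /= inordK //.
    have := ltn_expl N (isT : 1 < 3); lia.
  by have /orP[] := good_subboxes (good N.+1) ne; apply: far.
have [] := core_joined (good N.+1) (good N.+1) (or_introl erefl)
  (core_origin _ good) cs.
move=> p pp; case/shortenP: pp => {}p pp up _ ps; exists p; split=> //.
apply: (leq_trans Ns); rewrite -ps.
have : forall s q, path adj s q -> (last s q).1 <= s.1 + size q.
  move=> {Ns cs p pp up ps}s' q; elim: q s' => [|t q IH] s' /=;
    first by rewrite addn0.
  case/andP => /good_adjacent_step st /IH; lia.
by move/(_ _ _ pp); rewrite add0n.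
Qed.
End Boxes.

(** * Spread-out lengths, and routes between neighbouring sites *)

(** Abscissa of a vertex relative to its site: the entries use a candidate length
   alone, the inner vertices of routes also use a lane length. *)
Definition offset (A X : Type) (f : A -> nat) (l : X -> nat)
    (o : option A * option X) : nat :=
  oapp f 0 o.1 + oapp l 0 o.2.

(** Each length is more than twice the preceding ones, with the [f] before the [l]
   and [L] last: sums of one [f] and one [l] are then pairwise distinct, and even
   distinct modulo [L]. *)
Lemma spread_lengths (Q : nat -> Prop) (A X : finType) :
  (forall N, exists2 i, N < i & Q i) ->
  exists (f : A -> nat) (l : X -> nat) (L : nat),
    [/\ forall a, 0 < f a /\ Q (f a), forall x, 0 < l x /\ Q (l x), Q L,
        injective (offset f l) & forall o, offset f l o < L].
Proof.
move=> /(_ _)/cid2 infQ.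
pose h N := projT1 (infQ N).
have hgt N : N < h N by rewrite /h; case: (infQ N).
have hQ N : Q (h N) by rewrite /h; case: (infQ N).
pose g k := iter k (fun n => h (2 * n)) (h 0).
have g0 k : 0 < g k by case: k => [|k] /=; apply: leq_ltn_trans (hgt _).
have gQ k : Q (g k) by case: k => [|k] /=; apply: hQ.
have gS i j : i < j -> 2 * g i < g j.
  elim: j => // j IH; rewrite ltnS leq_eqVlt => /orP[/eqP->|/IH];
    by have := hgt (2 * g j); rewrite /g /=; lia.
pose f (a : A) := g (enum_rank a).
pose l (x : X) := g (#|A| + enum_rank x).
have fl oa x : 2 * oapp f 0 oa < l x.
  case: oa => [a|] /=; last by rewrite muln0 g0.
  by apply: gS; apply: ltn_addr.
have finj oa oa' : oapp f 0 oa = oapp f 0 oa' -> oa = oa'.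
  case: oa oa' => [a|] [a'|] //=; rewrite /f => E.
  - congr Some; apply: enum_rank_inj; apply: val_inj => /=.
    case: (ltngtP (enum_rank a) (enum_rank a')) => // /gS; lia.
  - by have := g0 (enum_rank a); rewrite E.
  - by have := g0 (enum_rank a'); rewrite -E.
have lS x x' : [\/ x = x', 2 * l x < l x' | 2 * l x' < l x].
  case: (ltngtP (enum_rank x) (enum_rank x')) => xx'.
  - by apply: Or32; apply: gS; rewrite ltn_add2l.
  - by apply: Or33; apply: gS; rewrite ltn_add2l.
  - by apply: Or31; apply: enum_rank_inj; apply: val_inj.
exists f, l, (g (#|A| + #|X|)); split=> [a|x|||];
  [by split; [apply: g0|apply: gQ]|by split; [apply: g0|apply: gQ]|exact: gQ| |].
- move=> [oa [x|]] [oa' [x'|]]; rewrite /offset /=.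
  + have := fl oa x; have := fl oa' x'.
    case: (lS x x') => [->|?|?] ? ? E; try lia.
    by congr pair; apply: finj; lia.
  + by have := fl oa' x; lia.
  + by have := fl oa x'; lia.
  + by rewrite !addn0 => /finj ->.
- move=> [oa [x|]]; rewrite /offset /=.
  + have : 2 * l x < g (#|A| + #|X|) by apply: gS; rewrite ltn_add2l.
    by move: (fl oa x); move: (l x) (oapp f 0 oa) (g _) => *; lia.
  + rewrite addn0; case: oa => [a|] /=; last exact: g0.
    have : 2 * f a < g (#|A| + #|X|) by apply: gS; apply: ltn_addr.
    by move: (f a) (g _) => *; lia.
Qed.

Section Routes.
Variables A J : finType.

(** A lane is a triple made of the direction of the macroscopic edges that it
   serves, the parity of the coordinate of their first end in this direction, and
   an index.  The parity keeps apart the lanes of two consecutive edges, which meet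
   in their common site. *)
Definition position : Type :=
  (site * (option A * option (bool * bool * J)))%type.

Definition parity (d : bool) (s : site) : bool := odd (if d then s.1 else s.2).
Definition backward (d : bool) (s : site) : site :=
  if d then (s.1.-1, s.2) else (s.1, s.2.-1).

Definition entry (s : site) (a : A) : position := (s, (Some a, None)).

Definition route (d : bool) (s : site) (j : J) (a b : A) : seq position :=
  let x := Some (d, parity d s, j) in
  [:: (s, (Some a, x)); (s, (None, x));
      (forward d s, (None, x)); (forward d s, (Some b, x))].

(** The macroscopic edge, given by its direction and first end, that the lane of a
   vertex serves, and the index of the lane; [None] for vertices outside of all
   lanes.  The lane, which records a parity, tells whether the site of the vertex
   is the first or the second end of the edge. *)
Definition macro_lane (v : position) : option (bool * site * J) :=
  if v.2.2 is Some (d, q, j) then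
    Some (d, if parity d v.1 == q then v.1 else backward d v.1, j)
  else None.

Definition owner (v : position) : site + bool * site :=
  if macro_lane v is Some (d, s, _) then inr (d, s) else inl v.1.

Lemma parity_forward d s : parity d (forward d s) = ~~ parity d s.
Proof. by case: d. Qed.

Lemma backward_forward d s : backward d (forward d s) = s.
Proof. by case: d s => -[]. Qed.

Lemma macro_lane_route d s j a b v :
  v \in route d s j a b -> macro_lane v = Some (d, s, j).
Proof.
rewrite !inE => /or4P[] /eqP ->; rewrite /macro_lane /= ?eqxx //;
  by rewrite parity_forward backward_forward; case: (parity d s).
Qed.

Lemma owner_route d s j a b v : v \in route d s j a b -> owner v = inr (d, s).
Proof. by move/macro_lane_route; rewrite /owner => ->. Qed.

Lemma uniq_route d s j a b : uniq (route d s j a b).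
Proof.
have ne : s != forward d s by case: d s => -[x y]; rewrite xpair_eqE /=; lia.
by rewrite /= !inE !xpair_eqE (negbTE ne) /= !andbF.
Qed.

Variables (lab : position -> bool) (opn : rel position).
Hypothesis opn_sym : symmetric opn.

Definition hit d s j a b (w : 4.-tuple bool) : bool :=
  path opn (entry s a) (rcons (route d s j a b) (entry (forward d s) b)) &&
  (map lab (route d s j a b) == w).

(** The possible defects of a site: no entry has label [y], or no lane of the edge in
   direction [d] connects the entries [a] and [b] while reading [w]. *)
Definition fails (s : site)
    (r : bool + bool * A * A * 4.-tuple bool) : bool :=
  match r with
  | inl y => [forall a, lab (entry s a) != y]
  | inr (d, a, b, w) => [forall j, ~~ hit d s j a b w]
  end.

Definition bad_site (s : site) : bool := [exists r, fails s r].

Definition visited (p : seq site) (v : position) : bool :=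
  match owner v with
  | inl s => s \in p
  | inr (d, s) => (s \in p) && (forward d s \in p)
  end.

(** Edges are symmetric, so that a backward step follows a route of the other site
   in reverse, reading the reversed letters. *)
Lemma good_step s s' a (w : 4.-tuple bool) (y : bool) :
  good_adjacent bad_site s s' ->
  exists d r b, [/\ path opn (entry s a) (rcons r (entry s' b)),
    map lab r = w, lab (entry s' b) = y, uniq r &
    exists s0, ((s, s') = (s0, forward d s0) \/ (s', s) = (s0, forward d s0)) /\
      forall v, v \in r -> owner v = inr (d, s0)].
Proof.
case/and3P => gs gs' /existsP[d ss'].
have [b yb] : exists b, lab (entry s' b) = y.
  have /existsPn/(_ (inl y)) := gs'; rewrite negb_forall => /existsP[b].
  by rewrite negbK => /eqP; exists b.
case/orP: ss' => /eqP Es.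
  subst s'; have /existsPn/(_ (inr (d, a, b, w))) := gs.
  rewrite negb_forall => /existsP[j]; rewrite negbK => /andP[pr /eqP lr].
  exists d, (route d s j a b), b; split=> //; first exact: uniq_route.
  by exists s; split; [left | move=> v /owner_route].
have /existsPn/(_ (inr (d, b, a, [tuple of rev w]))) := gs'.
rewrite negb_forall => /existsP[j]; rewrite negbK => /andP[pr /eqP lr].
exists d, (rev (route d s' j b a)), b; split=> //.
- have S u v : opn u v -> opn v u by rewrite opn_sym.
  move: pr; rewrite -Es /= !andbT => /and5P[h1 h2 h3 h4 h5].
  by apply/and5P; split; apply: S.
- by rewrite map_rev lr revK.
- by rewrite rev_uniq uniq_route.
- exists s'; split; first by right; rewrite Es.
  by move=> v; rewrite mem_rev => /owner_route.
Qed.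

(** Each macroscopic step consumes five letters: four along a lane, one at the next
   entry.  A self-avoiding macroscopic path uses each site and each edge at most
   once, and each vertex used is owned by a site or an edge of the path, so the
   microscopic path does not meet itself either. *)
Lemma word_along_path p s a (w : seq bool) :
  path (good_adjacent bad_site) s p -> uniq (s :: p) -> size w = 5 * size p ->
  exists vs, [/\ path opn (entry s a) vs, map lab vs = w, uniq vs &
    forall v, v \in vs -> owner v != inl s /\ visited (s :: p) v].
Proof.
elim: p s a w => [|s' p IH] s a w; first by case: w => // _ _ _; exists [::].
move=> /= /andP[adj pp] /and3P[sp s'p up] sw.
have sw4 : size (take 4 w) == 4 by rewrite size_takel // sw mulnS.
have [d [r [b [pr lr lb ur [s0 [Es0 or]]]]]] :=
  good_step a (Tuple sw4) (nth false w 4) adj.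
have [||vs [pvs lvs uvs ovs]] := IH s' b (drop 5 w) pp.
- by rewrite /= s'p.
- by rewrite size_drop sw mulnS addKn.
have new v : v \in vs -> (v != entry s' b) /\ v \notin r.
  move=> vvs; have [os' wv] := ovs v vvs; split.
    by apply: contraNneq os' => ->.
  apply: contraL wv => /or; rewrite /visited => ->; rewrite negb_and.
  by case: Es0 => -[<- <-]; rewrite sp ?orbT.
exists (rcons r (entry s' b) ++ vs); split.
- by rewrite cat_path pr last_rcons.
- rewrite map_cat map_rcons lr lb lvs /= -cats1 -catA /=.
  rewrite -[RHS](cat_take_drop 4 w); congr cat.
  by rewrite (@drop_nth _ false 4) // sw mulnS.
- rewrite cat_uniq uvs andbT rcons_uniq ur andbT; apply/andP; split.
    by apply/negP => /or.
  apply/hasPn => v /new[v1 v2]; by rewrite mem_rcons inE negb_or v1.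
- move=> v; rewrite mem_cat mem_rcons inE -orbA => /or3P[/eqP->|vr|vvs].
  + rewrite /visited /owner /= !inE eqxx orbT; split=> //.
    apply: contraNneq sp => -[->]; by rewrite inE eqxx.
  + rewrite /visited (or v vr) !inE; split=> //.
    by case: Es0 => -[<- <-]; rewrite !eqxx !orbT.
  + have [os' wv] := ovs v vvs; move: wv; rewrite /visited.
    case: (owner v) => [t|[d' t]].
      move=> tin; split; last by rewrite inE tin orbT.
      by apply: contraNneq sp => -[<-].
    by case/andP => t1 t2; split=> //; rewrite inE t1 orbT /= inE t2 orbT.
Qed.

End Routes.

Local Open Scope classical_set_scope.
Local Open Scope ring_scope.

(** * Independence of events that depend on disjoint sets of coordinates *)

Section Dependence.
Variable I : choiceType.
Implicit Types (F G : (I -> bool) -> bool) (S : set I).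

Definition determined (J : seq I) F : Prop :=
  forall c c', {in J, c =1 c'} -> F c = F c'.

(** Finiteness of [J] makes the event measurable and allows induction on the number
   of coordinates. *)
Definition depends S F : Prop :=
  exists J : seq I, (forall j, j \in J -> S j) /\ determined J F.

Definition set_coord (j : I) (b : bool) (c : I -> bool) : I -> bool :=
  fun i => if i == j then b else c i.

Lemma set_coord_id j c : set_coord j (c j) c = c.
Proof. by apply/funext => i; rewrite /set_coord; case: eqP => [->|]. Qed.

Lemma determined_set_coord j J F b :
  determined (j :: J) F -> determined J (F \o set_coord j b).
Proof.
move=> dF c c' cc'; apply: dF => i; rewrite inE /set_coord => /orP[->//|iJ].
by case: ifP => // _; apply: cc'.
Qed.

Lemma determined_undup J F : determined J F -> determined (undup J) F.
Proof.
by move=> dF c c' cc'; apply: dF => i iJ; apply: cc'; rewrite mem_undup.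
Qed.

Lemma depends_sub S S' F : S `<=` S' -> depends S F -> depends S' F.
Proof. by move=> SS' [J [JS dF]]; exists J; split=> // j /JS /SS'. Qed.

Lemma depends_comp S (K : finType) (F : K -> (I -> bool) -> bool)
    (g : (K -> bool) -> bool) :
  (forall k, depends S (F k)) -> depends S (fun c => g (fun k => F k c)).
Proof.
move=> /choice[J dF]; exists (flatten [seq J k | k <- enum K]); split.
  by move=> j /flatten_mapP[k _]; apply: (dF k).1.
move=> c c' cc'; congr g; apply/funext => k; apply: (dF k).2 => i iJ.
by apply: cc'; apply/flatten_mapP; exists k; rewrite // mem_enum.
Qed.

End Dependence.

Section Independence.
Context (R : realType) (d : measure_display) (T : measurableType d)
  (P : probability T R) (I : choiceType) (X : I -> {RV P >-> bool}).
Hypothesis indep : mutually_independent X.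
Implicit Types (F G : (I -> bool) -> bool) (S : set I) (J : seq I).

Definition event F : set T := [set t | F (fun i => X i t)].
Definition prob F : R := fine (P (event F)).

Definition slice (i : I) (b : bool) : set T := X i @^-1` [set b].

Lemma measurable_slice (i : I) (B : set bool) : measurable (X i @^-1` B).
Proof. exact: measurable_funPTI. Qed.

(** Conditioning on one coordinate: by induction on the number of coordinates, this
   reduces events that depend on finitely many of them to cylinders, for which
   independence is the hypothesis. *)
Lemma event_split j F : event F =
  (event (F \o set_coord j true) `&` slice j true) `|`
  (event (F \o set_coord j false) `&` slice j false).
Proof.
rewrite /event /slice; apply/seteqP; split=> t /=.
  have := set_coord_id j (fun i => X i t).
  by case E : (X j t) => Ec Ft; [left|right]; rewrite Ec.
have := set_coord_id j (fun i => X i t).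
by case: (X j t) => Ec [] [] // + _; rewrite Ec.
Qed.

Lemma determined_nil F : determined [::] F ->
  event F = setT \/ event F = set0.
Proof.
move=> dF; case E : (F (fun=> true)); [left|right];
  apply/seteqP; split=> t //=; rewrite /event /=;
  by rewrite (dF _ (fun=> true)) ?E.
Qed.

Lemma measurable_determined J F : determined J F -> measurable (event F).
Proof.
elim: J F => [|j J IH] F dF.
  by case: (determined_nil dF) => ->.
rewrite (event_split j); apply: measurableU; apply: measurableI;
  by [apply: IH; apply: determined_set_coord | apply: measurable_slice].
Qed.

Lemma measurable_event S F : depends S F -> measurable (event F).
Proof. by case=> J [_ /measurable_determined]. Qed.

Definition cylinder (J : {fset I}) (B : I -> set bool) : set T :=
  \bigcap_(j in [set` J]) (X j @^-1` B j).

Lemma measurable_cylinder (J : {fset I}) B : measurable (cylinder J B).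
Proof.
by apply: fin_bigcap_measurable => // j _; apply: measurable_slice.
Qed.

Lemma fine_P_setU A B : measurable A -> measurable B -> A `&` B = set0 ->
  fine (P (A `|` B)) = fine (P A) + fine (P B).
Proof.
by move=> mA mB AB; rewrite measureU // fineD // fin_num_measure.
Qed.

Definition pin (j : I) (b : bool) (B : I -> set bool) : I -> set bool :=
  fun i => if i == j then [set b] else B i.

Lemma cylinder_pin j b (J : {fset I}) B : j \notin J ->
  slice j b `&` cylinder J B = cylinder (j |` J)%fset (pin j b B).
Proof.
move=> jJ; apply/seteqP; split=> t.
  move=> [tj tJ] i /= /fset1UP[->|iJ]; first by rewrite /pin eqxx.
  rewrite /pin; case: eqP => [->//|_]; exact: tJ.
move=> tJ; split.
  by have := tJ j; rewrite /= /pin eqxx; apply; apply: fset1U1.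
move=> i /= iJ; have := tJ i; rewrite /= /pin.
case: eqP => [ij|_]; first by rewrite -ij iJ in jJ.
by apply; apply: fset1Ur.
Qed.

Lemma fine_cylinder_pin j b (J : {fset I}) B : j \notin J ->
  fine (P (slice j b `&` cylinder J B)) =
  fine (P (slice j b)) * fine (P (cylinder J B)).
Proof.
move=> jJ; rewrite cylinder_pin // /cylinder !indep //.
have fin i C : P (X i @^-1` C) \is a fin_num.
  by apply: fin_num_measure; apply: measurable_slice.
rewrite big_fsetU1 //= {1}/pin eqxx fineM ?prode_fin_num //.
congr (_ * fine _); apply: eq_big_seq => i iJ; rewrite /pin.
by case: eqP => // ij; rewrite -ij iJ in jJ.
Qed.

Lemma event_cylinder_split j F (J : {fset I}) B E : j \notin J ->
  measurable (event (F \o set_coord j true)) ->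
  measurable (event (F \o set_coord j false)) -> measurable E ->
  fine (P (event F `&` E `&` cylinder J B)) =
  fine (P (event (F \o set_coord j true) `&` E `&`
           cylinder (j |` J)%fset (pin j true B))) +
  fine (P (event (F \o set_coord j false) `&` E `&`
           cylinder (j |` J)%fset (pin j false B))).
Proof.
move=> jJ m1 m0 mE; rewrite -!cylinder_pin // -fine_P_setU.
- congr (fine (P _)); rewrite (event_split j F) !setIUl.
  by congr (_ `|` _); rewrite -!setIA; congr (_ `&` _); rewrite setICA.
- by do ?apply: measurableI => //;
    [apply: measurable_slice|apply: measurable_cylinder].
- by do ?apply: measurableI => //;
    [apply: measurable_slice|apply: measurable_cylinder].
- apply/seteqP; split=> t // -[[_ [+ _]] [_ [+ _]]].
  by rewrite /slice /= => ->.
Qed.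

(** Independence of an event and a cylinder on other coordinates.  Conditioning on a
   coordinate of [F] enlarges the cylinder, whose probability factors. *)
Lemma fine_determined_cylinder J F (K : {fset I}) B :
  uniq J -> determined J F -> {in J, forall j, j \notin K} ->
  fine (P (event F `&` cylinder K B)) = prob F * fine (P (cylinder K B)).
Proof.
elim: J F K B => [|j J IH] F K B.
  move=> _ /determined_nil[] E _; rewrite /prob E.
    by rewrite setTI probability_setT mul1r.
  by rewrite set0I measure0 mul0r.
move=> /= /andP[jJ uJ] dF JK.
have dFb b := determined_set_coord b dF.
have mFb b := measurable_determined (dFb b).
have jK : j \notin K by apply: JK; rewrite inE eqxx.
have dis i : i \in J -> i \notin (j |` K)%fset.
  move=> iJ; rewrite in_fset1U negb_or JK ?inE ?iJ ?orbT // andbT.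
  by apply: contraNneq jJ => <-.
have step B' : fine (P (event F `&` cylinder K B')) =
    \sum_(b : bool) prob (F \o set_coord j b) *
      (fine (P (slice j b)) * fine (P (cylinder K B'))).
  rewrite -(setIT (event F)) (event_cylinder_split _ jK) // !setIT.
  rewrite big_bool /= !IH // -!cylinder_pin // !fine_cylinder_pin //.
have -> : prob F =
    \sum_(b : bool) prob (F \o set_coord j b) * fine (P (slice j b)).
  rewrite /prob (event_split j F) big_bool /=.
  have sl b : slice j b = cylinder [fset j]%fset (fun=> [set b]).
    apply/seteqP; split=> t /=; first by move=> tj i /= /fset1P ->.
    by apply; rewrite /= inE.
  rewrite fine_P_setU.
  - have dis' i : i \in J -> i \notin [fset j]%fset.
      by move=> iJ; rewrite inE; apply: contraNneq jJ => <-.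
    by rewrite !sl !IH.
  - by apply: measurableI => //; apply: measurable_slice.
  - by apply: measurableI => //; apply: measurable_slice.
  - by apply/seteqP; split=> t // -[[_ +] [_ +]]; rewrite /slice /= => ->.
by rewrite step mulr_suml; apply: eq_bigr => b _; rewrite mulrA.
Qed.

(** Same induction, now on the coordinates of [G].  The cylinder collects the
   coordinates on which one has conditioned. *)
Lemma fine_determined2 J J' F G (K : {fset I}) B :
  uniq J -> uniq J' -> determined J F -> determined J' G ->
  {in J, forall j, j \notin K} -> {in J', forall j, j \notin K} ->
  {in J, forall j, j \notin J'} ->
  fine (P (event G `&` event F `&` cylinder K B)) =
  prob F * fine (P (event G `&` cylinder K B)).
Proof.
move=> uJ uJ' dF dG JK + JJ'.
elim: J' G K B uJ' dG JK JJ' => [|j J' IH] G K B.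
  move=> _ /determined_nil[] E JK _ _; rewrite E.
    by rewrite !setTI (fine_determined_cylinder _ uJ).
  by rewrite !set0I measure0 mulr0.
move=> /= /andP[jJ' uJ'] dG JK JJ' J'K.
have dGb b := determined_set_coord b dG.
have mGb b := measurable_determined (dGb b).
have jK : j \notin K by apply: J'K; rewrite inE eqxx.
have mF := measurable_determined dF.
rewrite (event_cylinder_split _ jK) // -(setIT (event G)).
rewrite (event_cylinder_split _ jK) // !setIT mulrDr.
have dis i : i \in J' -> i \notin (j |` K)%fset.
  move=> iJ; rewrite in_fset1U negb_or J'K ?inE ?iJ ?orbT // andbT.
  by apply: contraNneq jJ' => <-.
have dis2 i : i \in J -> i \notin (j |` K)%fset.
  move=> iJ; rewrite in_fset1U negb_or JK // andbT.
  by apply: contraTneq iJ => -> ; apply/negP => /JJ'; rewrite inE eqxx.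
have dis3 : {in J, forall i, i \notin J'}.
  by move=> i /JJ'; rewrite inE negb_or => /andP[].
by rewrite !IH.
Qed.

Lemma prob_and S S' F G : depends S F -> depends S' G -> S `&` S' = set0 ->
  prob (fun c => F c && G c) = prob F * prob G.
Proof.
move=> [J [JS dF]] [J' [JS' dG]] SS'.
have := @fine_determined2 (undup J) (undup J') F G fset0 (fun=> setT)
  (undup_uniq _) (undup_uniq _) (determined_undup dF) (determined_undup dG).
have -> : cylinder fset0 (fun=> setT) = setT.
  by apply/seteqP; split=> // t _ i; rewrite /= inE.
rewrite !setIT; move=> <- //.
- congr (fine (P _)); apply/seteqP; split=> t; rewrite /event /=.
    by case/andP.
  by case=> ? ?; apply/andP.
- move=> j; rewrite !mem_undup => /JS Sj; apply/negP => /JS' S'j.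
  by have : (S `&` S') j by []; rewrite SS'.
Qed.

Lemma prob_ge0 F : 0 <= prob F.
Proof. exact: fine_ge0. Qed.

Lemma prob_le1 S F : depends S F -> prob F <= 1.
Proof.
move=> dF; rewrite -lee_fin fineK ?fin_num_measure ?probability_le1 //;
  exact: measurable_event dF.
Qed.

Lemma prob_not S F : depends S F -> prob (fun c => ~~ F c) = 1 - prob F.
Proof.
move=> dF; have mF := measurable_event dF.
have -> : 1 = fine (P setT) by rewrite probability_setT.
rewrite -(setvU (event F)) fine_P_setU //; last by rewrite setICl.
- rewrite addrK; congr (fine (P _)); apply/seteqP; split=> t /= /negP //.
- exact: measurableC.
Qed.

Lemma prob_exists S (K : finType) (F : K -> (I -> bool) -> bool) :
  (forall k, depends S (F k)) ->
  prob (fun c => [exists k, F k c]) <= \sum_k prob (F k).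
Proof.
move=> dF; pose H (s : seq K) c := has (F^~ c) s.
have dH s : depends S (H s).
  by apply: (depends_comp (fun f : K -> bool => has f s)).
have -> : prob (fun c => [exists k, F k c]) = prob (H (enum K)).
  congr (fine (P _)); apply/seteqP; split=> t; rewrite /event /H /=.
    by case/existsP => k Fk; apply/hasP; exists k; rewrite ?mem_enum.
  by case/hasP => k _ Fk; apply/existsP; exists k.
rewrite -big_enum /=; elim: (enum K) => [|k s IH].
  rewrite big_nil /prob; have -> : event (H [::]) = set0 by apply/seteqP; split.
  by rewrite measure0.
rewrite big_cons; apply: le_trans (lerD (lexx _) IH).
have m1 := measurable_event (dF k); have m2 := measurable_event (dH s).
rewrite /prob -fineD ?fin_num_measure //.
have -> : event (H (k :: s)) = event (F k) `|` event (H s).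
  by apply/seteqP; split=> t; rewrite /event /H /=; [case/orP|case=> ->];
    rewrite ?orbT; [left|right| |].
apply: fine_le; rewrite ?fin_numD ?fin_num_measure //; first exact: measurableU.
exact: measureU2.
Qed.

Lemma prob_all_fail (K : finType) (S : K -> set I)
    (H : K -> (I -> bool) -> bool) (rho : R) : rho <= 1 ->
  (forall k, depends (S k) (H k)) -> (forall k k' i, S k i -> S k' i -> k = k') ->
  (forall k, rho <= prob (H k)) ->
  prob (fun c => [forall k, ~~ H k c]) <= (1 - rho) ^+ #|K|.
Proof.
move=> rho1 dH dis Hrho.
pose A (s : seq K) c := all (fun k => ~~ H k c) s.
have dA s : depends [set i | exists2 k, k \in s & S k i] (A s).
  have [J dJ] := choice dH.
  exists (flatten [seq J k | k <- s]); split.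
    by move=> j /flatten_mapP[k ks jk]; exists k => //; apply: (dJ k).1.
  move=> c c' cc'; apply: eq_in_all => k ks; congr negb; apply: (dJ k).2 => i iJ.
  by apply: cc'; apply/flatten_mapP; exists k.
have AK : prob (fun c => [forall k, ~~ H k c]) = prob (A (enum K)).
  congr (fine (P _)); apply/seteqP; split=> t; rewrite /event /A /=.
    by move=> /forallP Hk; apply/allP => k _.
  by move=> /allP Hk; apply/forallP => k; apply: Hk; rewrite mem_enum.
rewrite AK cardE; have := enum_uniq K; elim: (enum K) => [|k s IH] /=.
  by move=> _; rewrite expr0; apply: (prob_le1 (dA [::])).
move=> /andP[ks us].
rewrite (@prob_and (S k) _ _ (A s) _ (dA s)).
- rewrite exprS ler_pM ?prob_ge0 ?IH // (prob_not (dH k)) lerB //.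
- by apply: (depends_comp (fun f : unit -> bool => ~~ f tt) (F := fun=> H k)).
- apply/seteqP; split=> i // -[Ski [k' k's Sk'i]].
  by move: ks; rewrite (dis _ _ _ Ski Sk'i) k's.
Qed.

(** The coordinates in [s] may repeat, which only helps as [sigma <= 1]. *)
Lemma cylinder_ge (s : seq I) (B : I -> set bool) (sigma : R) :
  0 <= sigma -> sigma <= 1 ->
  (forall i, i \in s -> sigma%:E <= P (X i @^-1` B i))%E ->
  sigma ^+ size s <= fine (P (cylinder [fset i in s]%fset B)).
Proof.
move=> s0 s1 sB; rewrite /cylinder indep; last by [].
apply: (@le_trans _ _ (sigma ^+ size (undup s))).
  by rewrite ler_wiXn2l // size_undup.
have -> : (\prod_(j <- [fset i in s]%fset) P (X j @^-1` B j) =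
           \prod_(j <- undup s) P (X j @^-1` B j))%E.
  apply: perm_big; apply: uniq_perm; rewrite ?undup_uniq ?fset_uniq //.
  by move=> i; rewrite !inE mem_undup.
have : forall j, j \in undup s -> sigma <= fine (P (X j @^-1` B j)).
  move=> j; rewrite mem_undup => /sB; rewrite -lee_fin fineK //.
  by rewrite fin_num_measure //; apply: measurable_slice.
have fin i : P (X i @^-1` B i) \is a fin_num.
  by rewrite fin_num_measure //; apply: measurable_slice.
elim: (undup s) => [|j u IH] su; first by rewrite big_nil expr0.
rewrite big_cons fineM ?prode_fin_num //= exprS ler_pM ?exprn_ge0 //.
- by apply: su; rewrite inE eqxx.
- by apply: IH => i iu; apply: su; rewrite inE iu orbT.
Qed.

Lemma in_cylinder (s : seq I) (B : I -> set bool) t i :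
  cylinder [fset i in s]%fset B t -> i \in s -> B i (X i t).
Proof. by move=> ct si; apply: ct; rewrite /= inE. Qed.

Section Boxes.
Variables (bad : (I -> bool) -> pred site) (S : site -> set I) (x : R).
Hypothesis S_disjoint : forall s s' i, S s i -> S s' i -> s = s'.
Hypothesis bad_depends : forall s, depends (S s) (bad^~ s).
Hypothesis prob_bad : forall s, prob (bad^~ s) <= x.
Hypothesis x_small : 162 * x <= 1.

Definition box_coords k (B : site) : set I :=
  [set i | exists2 s, S s i & (s.1 %/ 3 ^ k, s.2 %/ 3 ^ k)%N = B].

Lemma subbox_inj B : injective (subbox B).
Proof.
move=> [i j] [i' j'] [/= /addnI ii' /addnI jj'].
by congr pair; apply: val_inj.
Qed.

Lemma box_coords_sub k B p : box_coords k (subbox B p) `<=` box_coords k.+1 B.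
Proof.
move=> i [s Ssi [s1 s2]]; exists s => //.
rewrite !expnSr !divnMA s1 s2 /= !(mulnC 3) !divnMDl // !divn_small // !addn0.
by case: B {s1 s2}.
Qed.

Lemma bad_box_depends k B :
  depends (box_coords k B) (fun c => bad_box (bad c) k B).
Proof.
elim: k B => [|k IH] B /=.
  apply: depends_sub (bad_depends B) => i SBi; exists B => //.
  by rewrite expn0 !divn1; case: B {SBi}.
apply: (depends_comp (fun f : 'I_3 * 'I_3 -> bool =>
  [exists pp : ('I_3 * 'I_3) * ('I_3 * 'I_3),
    [&& pp.1 != pp.2, f pp.1 & f pp.2]])
  (F := fun p c => bad_box (bad c) k (subbox B p))) => p.
apply: depends_sub (IH _); exact: box_coords_sub.
Qed.

(** There are [81] pairs of sub-boxes and distinct sub-boxes are independent, so the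
   bound [y] at scale [k] becomes [81 * y ^+ 2 <= y / 2], by [162 * x <= 1]. *)
Lemma prob_bad_box k B : prob (fun c => bad_box (bad c) k B) <= x / 2 ^+ k.
Proof.
have x0 : 0 <= x by apply: le_trans (prob_bad (0, 0)%N); apply: prob_ge0.
elim: k B => [|k IH] B /=; first by rewrite expr0 divr1.
have dB k' B' := bad_box_depends k' B'.
have dsub p : depends (box_coords k.+1 B)
    (fun c => bad_box (bad c) k (subbox B p)).
  by apply: depends_sub (dB _ _); apply: box_coords_sub.
pose y := x / 2 ^+ k.
have y0 : 0 <= y by rewrite divr_ge0 // exprn_ge0.
have yx : y <= x.
  by rewrite ler_pdivrMr ?exprn_gt0 // ler_peMr // exprn_ege1 // ler1n.
apply: le_trans (prob_exists (S := box_coords k.+1 B) _) _.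
  move=> -[p p'] /=.
  apply: (depends_comp (fun f : bool -> bool => [&& p != p', f true & f false])
    (F := fun b c => bad_box (bad c) k (subbox B (if b then p else p')))).
  by move=> b; apply: dsub.
apply: (@le_trans _ _ (\sum_(pp : ('I_3 * 'I_3) * ('I_3 * 'I_3)) y ^+ 2)).
  apply: ler_sum => -[p p'] _ /=; case: eqP => [_|/eqP ne] /=.
    rewrite /prob; set E := event _; have -> : E = set0 by apply/seteqP; split.
    by rewrite measure0 exprn_ge0.
  rewrite (prob_and (dB k (subbox B p)) (dB k (subbox B p'))).
    by rewrite expr2 ler_pM ?prob_ge0 // IH.
  apply/seteqP; split=> // i -[[s Ssi sB] [s' Ss'i s'B]].
  move/eqP: ne; apply; apply: (@subbox_inj B).
  by rewrite -sB -s'B (S_disjoint Ssi Ss'i).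
have -> : x / 2 ^+ k.+1 = y / 2 by rewrite /y exprSr invfM mulrA.
rewrite sumr_const card_prod card_prod card_ord -mulr_natl.
have : y * x <= y * 162^-1.
  by rewrite ler_wpM2l // -[162^-1]mul1r ler_pdivlMr // mulrC.
have : y * y <= y * x by rewrite ler_wpM2l.
by rewrite expr2; move: (y * y) (y * x) => u v; lra.
Qed.

(** Union bound over the scales: the bounds [x / 2 ^+ k] add up to [2 * x]. *)
Lemma prob_all_boxes_good :
  let A := [set t | forall k, ~~ bad_box (bad (fun i => X i t)) k (0, 0)%N] in
  measurable A /\ ((1 - 2 * x)%:E <= P A)%E.
Proof.
pose E k := event (fun c => bad_box (bad c) k (0, 0)%N).
move=> A; have mE k : measurable (E k).
  by apply: measurable_event (bad_box_depends _ _).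
have AE : A = ~` (\bigcup_k E k).
  apply/seteqP; split=> t.
    by move=> At [k _]; rewrite /E /event /= (negbTE (At k)).
  by move=> nE k; apply/negP => bk; apply: nE; exists k.
have mU : measurable (\bigcup_k E k) by apply: bigcupT_measurable.
split; first by rewrite AE; apply: measurableC.
rewrite AE probability_setC // EFinB leeB //.
apply: le_trans (generalized_Boole_inequality _ mE _) _ => //.
apply: lime_le; first exact: is_cvg_nneseries.
apply: nearW => n.
have x0 : 0 <= x by apply: le_trans (prob_bad (0, 0)%N); apply: prob_ge0.
have : \sum_(0 <= k < n) x / 2 ^+ k <= 2 * x.
  suff -> : \sum_(0 <= k < n) x / 2 ^+ k = 2 * x - 2 * x / 2 ^+ n.
    by rewrite lerBlDr lerDl !mulr_ge0 // invr_ge0 exprn_ge0.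
  elim: n => [|n IH]; first by rewrite big_geq // expr0; lra.
  rewrite big_nat_recr //= IH exprSr invfM; lra.
rewrite -lee_fin; apply: le_trans; rewrite -sumEFin; apply: lee_sum => k _.
have := prob_bad_box k (0, 0)%N.
by rewrite -lee_fin /prob fineK // fin_num_measure //; apply: mE.
Qed.
End Boxes.

End Independence.

(** * Compactness and measurability *)

Definition step (K : nat) (w : edges -> bool) : rel vertex :=
  fun u v => (dist u v <= K)%N && `[< is_open w u v >].

Definition seen_prefix K w (h : vertex -> bool) (x : vertex) (ws : seq bool) :=
  exists vs, [/\ path (step K w) x vs, uniq (x :: vs) & map h vs = ws].

Definition ball (K : nat) (u : vertex) : seq vertex :=
  [seq (u.1 + i, u.2 + j) | i <- [seq k%:Z - K%:Z | k <- iota 0 (K + K).+1],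
                            j <- [seq k%:Z - K%:Z | k <- iota 0 (K + K).+1]].

Lemma mem_ball K u v : (dist u v <= K)%N -> v \in ball K u.
Proof.
have mem (z : int) : (`|z| <= K)%N ->
    z \in [seq k%:Z - K%:Z | k <- iota 0 (K + K).+1].
  move=> zK; apply/mapP; exists (absz (z + K%:Z)); rewrite ?mem_iota; lia.
case: u v => u1 u2 [v1 v2]; rewrite /dist /= => duv.
apply/allpairsP; exists (v1 - u1, v2 - u2) => /=; split.
- by apply: mem; lia.
- by apply: mem; lia.
- by congr pair; lia.
Qed.

Section Koenig.
Variables (K : nat) (w : edges -> bool) (h : vertex -> bool) (x : vertex)
  (xi : word).

Definition extends (vs us : seq vertex) : Prop :=
  [/\ path (step K w) x (vs ++ us), uniq (x :: vs ++ us)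
    & map h (vs ++ us) = mkseq xi (size (vs ++ us))].

Definition live vs := forall n, exists us, size us = n /\ extends vs us.

Lemma extends_take vs us n : extends vs us -> extends vs (take n us).
Proof.
have E : vs ++ take n us = take (size vs + n) (vs ++ us).
  by rewrite takeD take_size_cat // drop_size_cat.
move=> [pe ue he]; rewrite /extends E; split.
- move: pe; rewrite -{1}(cat_take_drop (size vs + n) (vs ++ us)) cat_path.
  by case/andP.
- move: ue; rewrite -{1}(cat_take_drop (size vs + n) (vs ++ us)) -cat_cons.
  by rewrite cat_uniq => /andP[].
- rewrite map_take he size_take_min /mkseq -map_take take_iota.
  by congr map; congr iota; lia.
Qed.

(** If no prolongation by one vertex were live, each would stop before some length;
   finitely many vertices being within reach, a common bound would exist. *)
Lemma live_rcons vs : live vs -> exists v, live (rcons vs v).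
Proof.
move=> lvs; apply: contrapT => /forallNP nl.
have /choice[N HN] v :
    exists n, forall us, size us = n -> ~ extends (rcons vs v) us.
  have /existsNP[n Hn] := nl v; exists n => us sus exu; apply: Hn.
  by exists us.
pose M := \max_(v <- ball K (last x vs)) N v.
have [[|v us] [// [sus] exu]] := lvs M.+1.
have vM : (N v <= M)%N.
  apply: leq_bigmax_seq => //; case: exu => + _ _.
  by rewrite cat_path /= => /and3P[_ /andP[/mem_ball]].
apply: (HN v (take (N v) us)); first by rewrite size_takel // sus.
by apply: extends_take; rewrite /extends cat_rcons.
Qed.

(** Prolong the empty prefix by one vertex at a time, remaining live. *)
Lemma seen_koenig :
  (forall n, seen_prefix K w h x (mkseq xi n)) -> seen K w h x xi.
Proof.
move=> fin; have live0 : live [::].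
  move=> n; have [vs [pv uv hv]] := fin n; exists vs.
  have sv : size vs = n by rewrite -(size_map h) hv size_mkseq.
  by split=> //; split; rewrite // cat0s hv sv.
have /choice[g Hg] vs : exists v, live vs -> live (rcons vs v).
  have [l|nl] := pselect (live vs); last by exists x => l.
  by have [v lv] := live_rcons l; exists v.
pose vs n := iter n (fun s => rcons s (g s)) [::].
pose v n := last x (vs n).
have vsE n : vs n = mkseq (fun i => v i.+1) n.
  elim: n => [//|n IH]; rewrite mkseqS -IH /v /=; congr rcons.
  by rewrite last_rcons.
have lvs n : live (vs n) by elim: n => [|n IH] //=; apply: Hg.
have exv n : extends (vs n) [::].
  by have [us [/size0nil -> ]] := lvs n 0%N.
have xvs n : x :: vs n = mkseq v n.+1.
  by rewrite /mkseq /= vsE; congr cons; rewrite /mkseq (iotaDl 1 0) -map_comp.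
have hd i : v i.+1 = nth x (vs i.+1) i by rewrite [in RHS]vsE nth_mkseq.
exists v; split=> //.
- have lt_neq i j : (i < j)%N -> v i <> v j.
    move=> ij vij; have [_ + _] := exv j; rewrite cats0 xvs.
    have i_s : (i < size (mkseq v j.+1))%N by rewrite size_mkseq ltnS ltnW.
    have j_s : (j < size (mkseq v j.+1))%N by rewrite size_mkseq.
    move=> /(nth_uniq x i_s j_s); rewrite size_mkseq in i_s j_s.
    by rewrite !nth_mkseq // vij eqxx (ltn_eqF ij).
  by move=> i j vij; case: (ltngtP i j) => // /lt_neq []; rewrite vij.
- move=> i; have [+ _] := exv i.+1; rewrite cats0 => /(pathP x)/(_ i).
  rewrite {1}vsE size_mkseq ltnSn xvs nth_mkseq // -hd.
  move=> /(_ isT)/andP[dK /asboolP o] hv.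
  split=> //; rewrite hd -(nth_map x false h); last by rewrite vsE size_mkseq.
  by rewrite hv nth_mkseq // vsE size_mkseq.
Qed.
End Koenig.

Lemma prefix_of_seen K w h x xi n : seen K w h x xi ->
  seen_prefix K w h x (mkseq xi n).
Proof.
move=> [v [v0 vinj Hv]]; exists (mkseq (fun i => v i.+1) n); split.
- apply/(pathP x) => i; rewrite size_mkseq => i_n.
  have -> : nth x (x :: mkseq (fun i => v i.+1) n) i = v i.
    by case: i i_n => [//|i] i_n; rewrite /= nth_mkseq // ltnW.
  by rewrite nth_mkseq //; have [dK o _] := Hv i; rewrite /step dK; apply/asboolP.
- have -> : x :: mkseq (fun i => v i.+1) n = mkseq v n.+1.
    by rewrite /mkseq /= v0 (iotaDl 1 0) -map_comp.
  by rewrite map_inj_uniq ?iota_uniq.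
- rewrite /mkseq -map_comp; apply: eq_map => i /=.
  by have [_ _ ->] := Hv i.
Qed.

(** Quantifying over finite words makes the event countable, although there are
   uncountably many infinite words. *)
Lemma all_words_seenP K w h :
  words_seen K w h = setT <-> forall ws, seen_prefix K w h origin ws.
Proof.
split=> [W ws|H].
  have : words_seen K w h (nth false ws) by rewrite W.
  by move/(@prefix_of_seen _ _ _ _ _ (size ws)); rewrite mkseq_nth.
by apply/seteqP; split=> // xi _; apply: seen_koenig => n.
Qed.

Section Measurability.
Context (R : realType) d (T : measurableType d) (P : probability T R)
  (omega : edges -> {RV P >-> bool}) (eta : vertex -> {RV P >-> bool}).
Variable K : nat.

Lemma measurable_step u v : measurable [set t | step K (omega ^~ t) u v].
Proof.
have [dK|ndK] := boolP (dist u v <= K)%N; last first.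
  have -> : [set t | step K (omega ^~ t) u v] = set0; last by [].
  by apply/seteqP; split=> t //=; rewrite /step (negbTE ndK).
have [[e ve]|ne] := pselect (exists e : edges, val e = [fset u; v]%fset).
  have -> : [set t | step K (omega ^~ t) u v] = omega e @^-1` [set true].
    rewrite /step dK; apply/seteqP; split=> t /=.
      case/asboolP => e' ve' <-; congr (omega _ t).
      by apply: val_inj; rewrite ve ve'.
    by move=> oe; apply/asboolP; exists e.
  exact: measurable_funPTI.
have -> : [set t | step K (omega ^~ t) u v] = set0; last by [].
apply/seteqP; split=> t //=; case/andP => _ /asboolP[e ve _].
by apply: ne; exists e.
Qed.

Lemma measurable_const (b : bool) : measurable [set t : T | b].
Proof.
case: b.
  have -> : [set t : T | true] = setT by apply/seteqP; split.
  exact: measurableT.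
have -> : [set t : T | false] = set0 by apply/seteqP; split.
exact: measurable0.
Qed.

Lemma measurable_and (f g : T -> bool) :
  measurable [set t | f t] -> measurable [set t | g t] ->
  measurable [set t | f t && g t].
Proof.
move=> mf mg; have -> : [set t | f t && g t] = [set t | f t] `&` [set t | g t].
  by apply/seteqP; split=> t /= /andP.
exact: measurableI.
Qed.

Lemma measurable_seen_prefix ws :
  measurable [set t | seen_prefix K (omega ^~ t) (eta ^~ t) origin ws].
Proof.
have -> : [set t | seen_prefix K (omega ^~ t) (eta ^~ t) origin ws] =
    \bigcup_(vs : seq vertex)
      [set t | [&& path (step K (omega ^~ t)) origin vs, uniq (origin :: vs)
                 & map (eta ^~ t) vs == ws]].
  apply/seteqP; split=> t.
    by move=> [vs [pv uv /eqP hv]]; exists vs => //; apply/and3P.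
  by move=> [vs _ /and3P[pv uv /eqP hv]]; exists vs.
apply: countable_bigcupT_measurable => // vs.
apply: measurable_and.
  elim: vs (origin) => [|v vs IH] u /=; first exact: measurable_const.
  by apply: measurable_and; [apply: measurable_step|apply: IH].
apply: measurable_and; first exact: measurable_const.
elim: vs ws => [|v vs IH] [|b ws];
  [exact: (measurable_const true)|exact: (measurable_const false)|
   exact: (measurable_const false)|].
apply: (@measurable_and (fun t => eta v t == b)
  (fun t => map (eta ^~ t) vs == ws)); last exact: IH.
have -> : [set t | eta v t == b] = eta v @^-1` [set b].
  by apply/seteqP; split=> t /eqP.
exact: measurable_funPTI.
Qed.

Lemma measurable_all_words :
  measurable [set t | words_seen K (omega ^~ t) (eta ^~ t) = [set: word]].
Proof.
have -> : [set t | words_seen K (omega ^~ t) (eta ^~ t) = [set: word]] =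
    ~` \bigcup_(ws : seq bool)
      ~` [set t | seen_prefix K (omega ^~ t) (eta ^~ t) origin ws].
  apply/seteqP; split=> t /=.
    by move/all_words_seenP => H [ws _ nw]; exact: nw (H ws).
  move=> H; apply/all_words_seenP => ws; apply: contrapT => nw.
  by apply: H; exists ws.
apply: measurableC; apply: countable_bigcupT_measurable => // ws.
by apply: measurableC; apply: measurable_seen_prefix.
Qed.
End Measurability.

(** * Routes inside the percolation model *)

Lemma some_edge : edges.
Proof.
exists [fset (0 : int, 0 : int); (0 : int, 1 : int)]%fset.
by apply/mem_set; left; exists 0, 0, 1.
Qed.

(** Total in its arguments, with an irrelevant value on pairs of vertices that are
   not adjacent; [admissible] excludes these. *)
Definition mk_edge (u v : vertex) : edges := insubd some_edge [fset u; v]%fset.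

Lemma mk_edgeC u v : mk_edge u v = mk_edge v u.
Proof. by rewrite /mk_edge [in LHS]fsetUC. Qed.

Section Embedding.
Variables (A J : finType) (f : A -> nat) (l : bool * bool * J -> nat) (L : nat)
  (a0 : A) (Q : nat -> Prop).
Hypothesis f_good : forall a, (0 < f a)%N /\ Q (f a).
Hypothesis l_good : forall x, (0 < l x)%N /\ Q (l x).
Hypothesis L_good : Q L.
Hypothesis offset_inj : injective (offset f l).
Hypothesis offset_lt : forall o, (offset f l o < L)%N.

Implicit Types (u v : position A J).

(** The shift by [f a0] puts the entry [a0] of the first site at the origin. *)
Definition embed v : vertex :=
  ((v.1.1 * L + offset f l v.2)%:Z - (f a0)%:Z, v.1.2%:Z).

Lemma embed_inj : injective embed.
Proof.
move=> [[i t] o] [[i' t'] o'] [/= E ->].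
have {}E : (i * L + offset f l o = i' * L + offset f l o')%N by lia.
have L0 : (0 < L)%N by apply: leq_ltn_trans (offset_lt o).
have Ei : i = i'.
  by have := congr1 (divn^~ L) E; rewrite !divnMDl // !divn_small // !addn0.
by move: E; rewrite Ei => /addnI /offset_inj ->.
Qed.

Lemma inr_embed_inj u v :
  inr (embed u) = inr (embed v) :> edges + vertex -> u = v.
Proof.
move=> E; apply: embed_inj.
exact: (congr1 (fun i : edges + vertex => if i is inr x then x else origin) E).
Qed.

Lemma embed_origin : embed (entry J (0, 0)%N a0) = origin.
Proof. by rewrite /embed /offset /= mul0n addn0 subrr. Qed.

(** Pairs of vertices joined by an edge that is open with probability bounded
   below: horizontal of a length satisfying [Q], or vertical. *)
Definition link (x y : vertex) : Prop :=
  (exists2 i, (0 < i <= L)%N & [/\ Q i, `|x.1 - y.1| = i%:Z & x.2 = y.2]) \/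
  (x.1 = y.1 /\ `|x.2 - y.2| = 1).

Definition admissible (x y : vertex) : bool :=
  ([fset x; y]%fset \in edges) && (dist x y <= L)%N.

Lemma admissibleC x y : admissible x y = admissible y x.
Proof. by rewrite /admissible fsetUC /dist !(distnC x.1) !(distnC x.2). Qed.

Lemma link_admissible x y : link x y -> admissible x y.
Proof.
have L0 : (0 < L)%N by apply: leq_ltn_trans (offset_lt (None, None)).
case: x y => x1 x2 [y1 y2] [[i iL [/= _ dx ->]]|[/= -> dy]];
  (apply/andP; split; [apply/mem_set|rewrite /dist /=; lia]).
- by right; exists i; [rewrite /=; lia|exists x1, y1, y2].
- by left; exists y1, x2, y2.
Qed.

Definition route_edges d s j a b : seq (position A J * position A J) :=
  zip (entry J s a :: route d s j a b)
      (rcons (route d s j a b) (entry J (forward d s) b)).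

Lemma route_link d s j a b e : e \in route_edges d s j a b ->
  link (embed e.1) (embed e.2).
Proof.
have fL a' : (0 < f a' <= L)%N.
  have := offset_lt (Some a', None); rewrite /offset /= addn0 => /ltnW ->.
  by rewrite (f_good a').1.
have lL x : (0 < l x <= L)%N.
  have := offset_lt (None, Some x); rewrite /offset /= add0n => /ltnW ->.
  by rewrite (l_good x).1.
have LL : (0 < L <= L)%N by have := offset_lt (None, None); lia.
set x := (d, parity d s, j).
rewrite /route_edges /= -/x !inE => /or4P[|||/orP[]] /eqP -> /=.
- left; exists (l x) => //; rewrite /embed /offset /=.
  split=> //; [exact: (l_good x).2|lia].
- left; exists (f a) => //; rewrite /embed /offset /=.
  split=> //; [exact: (f_good a).2|lia].
- rewrite /embed /offset /forward; case: (d) => /=.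
    left; exists L => //; split=> //.
    rewrite /= mulSn; lia.
  right; split=> //=; lia.
- left; exists (f b) => //; rewrite /embed /offset /=.
  split=> //; [exact: (f_good b).2|lia].
- left; exists (l x) => //; rewrite /embed /offset /=.
  split=> //; [exact: (l_good x).2|lia].
Qed.

Definition label (c : edges + vertex -> bool) v : bool := c (inr (embed v)).
Definition opened (c : edges + vertex -> bool) u v : bool :=
  admissible (embed u) (embed v) && c (inl (mk_edge (embed u) (embed v))).

Lemma opened_sym c : symmetric (opened c).
Proof. by move=> u v; rewrite /opened admissibleC mk_edgeC. Qed.

Lemma val_mk_edge x y : admissible x y -> val (mk_edge x y) = [fset x; y]%fset.
Proof. by case/andP => e_in _; rewrite insubdK. Qed.

Lemma hitE c d s j a b w : hit (label c) (opened c) d s j a b w =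
  all (fun e => opened c e.1 e.2) (route_edges d s j a b) &&
  (map (label c) (route d s j a b) == w).
Proof. by []. Qed.

Definition ends (e : edges) : {fset vertex} := val e.

(** An edge of a route has at least one end in the lane of the route, and no end in
   another lane: this assigns each edge to a single lane. *)
Definition lane_coords (t : bool * site * J) : set (edges + vertex) :=
  [set i : edges + vertex | match i with
    | inl e => (exists2 v, embed v \in ends e & macro_lane v = Some t) /\
        (forall v, embed v \in ends e ->
           macro_lane v = None \/ macro_lane v = Some t)
    | inr x => exists2 v, embed v = x & macro_lane v = Some t
    end].

Lemma lane_coords_disjoint t t' i :
  lane_coords t i -> lane_coords t' i -> t = t'.
Proof.
case: i => [e|x] /=.
  by move=> [[v ve vt] _] [_ /(_ v ve)]; rewrite vt => -[|[]].
by move=> [v <- vt] [v' /embed_inj -> ]; rewrite vt => -[].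
Qed.

Lemma route_edge_coord d s j a b e : e \in route_edges d s j a b ->
  lane_coords (d, s, j) (inl (mk_edge (embed e.1) (embed e.2))).
Proof.
move=> ein; have adm := link_admissible (route_link ein).
pose on v := macro_lane v = Some (d, s, j).
have [H1 H2] : (on e.1 \/ on e.2) /\
    forall v, v = e.1 \/ v = e.2 -> macro_lane v = None \/ on v.
  have rt v := @macro_lane_route _ _ d s j a b v.
  move: ein rt; rewrite /route_edges /= !inE.
  by case/or4P => [|||/orP[]] /eqP -> rt; (split;
    [ try (by left; apply: rt; rewrite !inE eqxx ?orbT);
      by right; apply: rt; rewrite !inE eqxx ?orbT
    | move=> v [] ->; try (by right; apply: rt; rewrite !inE eqxx ?orbT);
      by left]).
rewrite /lane_coords /= /ends (val_mk_edge adm); split.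
  by case: H1 => H1; [exists e.1|exists e.2] => //; rewrite !inE eqxx ?orbT.
by move=> v; rewrite !inE => /orP[] /eqP /embed_inj E; apply: H2; [left|right].
Qed.

Lemma hit_depends d s j a b w : depends (lane_coords (d, s, j))
  (fun c => hit (label c) (opened c) d s j a b w).
Proof.
exists ([seq inl (mk_edge (embed e.1) (embed e.2))
          | e <- route_edges d s j a b] ++
        [seq inr (embed v) | v <- route d s j a b]); split.
  move=> i; rewrite mem_cat => /orP[/mapP[e er ->]|/mapP[v vr ->]].
    exact: route_edge_coord er.
  by exists v => //; apply: macro_lane_route vr.
move=> c c' cc'; rewrite !hitE; congr andb.
  apply: eq_in_all => e er; rewrite /opened cc' // mem_cat.
  by apply/orP; left; apply/mapP; exists e.
congr (_ == _); apply/eq_in_map => v vr; rewrite /label cc' // mem_cat.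
by apply/orP; right; apply/mapP; exists v.
Qed.

Definition site_coords (s : site) : set (edges + vertex) :=
  [set i | (exists a, i = inr (embed (entry J s a))) \/
           exists d j, lane_coords (d, s, j) i].

Lemma site_coords_disjoint s s' i : site_coords s i -> site_coords s' i -> s = s'.
Proof.
case=> [[a ->]|[d [j si]]] [[a' E]|[d' [j' s'i]]].
- by have [] := inr_embed_inj E.
- by case: s'i => v /embed_inj ->.
- by move: si; rewrite E => -[v /embed_inj ->].
- by case: (lane_coords_disjoint si s'i).
Qed.

Lemma label_depends s y a :
  depends [set inr (embed (entry J s a))] (fun c => label c (entry J s a) == y).
Proof.
exists [:: inr (embed (entry J s a))]; split=> [i|c c' cc'].
  by rewrite inE => /eqP.
by rewrite /label cc' // inE.
Qed.

Lemma fails_depends s r :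
  depends (site_coords s) (fun c => fails (label c) (opened c) s r).
Proof.
case: r => [y|[[[d a] b] w]] /=.
  apply: (depends_comp (fun g : A -> bool => [forall a, ~~ g a])
    (F := fun a c => label c (entry J s a) == y)) => a.
  by apply: depends_sub (label_depends s y a) => i ->; left; exists a.
apply: (depends_comp (fun g : J -> bool => [forall j, ~~ g j])
  (F := fun j c => hit (label c) (opened c) d s j a b w)) => j.
by apply: depends_sub (hit_depends _ _ _ _ _ _) => i si; right; exists d, j.
Qed.

Lemma bad_site_depends s :
  depends (site_coords s) (fun c => bad_site (label c) (opened c) s).
Proof.
apply: (depends_comp (fun g : _ -> bool => [exists r, g r])
  (F := fun r c => fails (label c) (opened c) s r)) => r.
exact: fails_depends.
Qed.

(** The number of letters read along a macroscopic path is a multiple of five: the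
   word is padded to that length, and the microscopic path cut afterwards. *)
Lemma seen_prefix_of_good_boxes (w : edges -> bool) (h : vertex -> bool) ws :
  let c := fun i => match i with inl e => w e | inr v => h v end in
  (forall k, ~~ bad_box (bad_site (label c) (opened c)) k (0, 0)%N) ->
  seen_prefix L w h origin ws.
Proof.
move=> c good.
have [p [pp up Np]] := good_boxes_long_path (size ws) good.
pose w' := ws ++ nseq (5 * size p - size ws) false.
have sw' : size w' = (5 * size p)%N by rewrite size_cat size_nseq; lia.
have [vs [pvs lvs uvs ovs]] :=
  word_along_path (@opened_sym c) a0 pp up sw'.
have sub v : v \in take (size ws) vs -> v \in vs by apply: mem_take.
exists (map embed (take (size ws) vs)); split.
- rewrite -embed_origin path_map.
  have : path (opened c) (entry J (0, 0)%N a0) (take (size ws) vs).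
    by move: pvs; rewrite -{1}(cat_take_drop (size ws) vs) cat_path => /andP[].
  apply: sub_path => u v /andP[adm ouv]; have /andP[_ dL] := adm.
  rewrite /step /= dL; apply/asboolP; exists (mk_edge (embed u) (embed v)) => //.
  exact: val_mk_edge.
- rewrite -embed_origin -map_cons map_inj_uniq; last exact: embed_inj.
  rewrite /= take_uniq // andbT; apply/negP => /sub /ovs[].
  by [].
- have -> : map h (map embed (take (size ws) vs)) =
      take (size ws) (map (label c) vs) by rewrite -map_comp map_take.
  by rewrite lvs /w' take_size_cat.
Qed.

Section Probability.
Context (R : realType) (q : nat -> R) (p eps sigma : R) (d : measure_display)
  (T : measurableType d) (P : probability T R)
  (omega : edges -> {RV P >-> bool}) (eta : vertex -> {RV P >-> bool}).
Hypothesis model : percolation_model L p eps q omega eta.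
Hypothesis sigma01 : 0 <= sigma <= 1.
Hypothesis sigma_q : forall i, Q i -> sigma <= q i.
Hypothesis sigma_eps : sigma <= eps.
Hypothesis sigma_p : sigma <= p.
Hypothesis sigma_1p : sigma <= 1 - p.

Let X (i : edges + vertex) : {RV P >-> bool} :=
  match i with inl e => omega e | inr v => eta v end.

Lemma X_independent : mutually_independent X.
Proof. by case: model. Qed.

Lemma label_prob (v : vertex) b : (sigma%:E <= P (X (inr v) @^-1` [set b]))%E.
Proof.
case: model => _ _ _ /(_ v) Hp; case: b; first by rewrite Hp lee_fin.
have -> : X (inr v) @^-1` [set false] = ~` (eta v @^-1` [set true]).
  by apply/seteqP; split=> t /=; case: (eta v t).
rewrite probability_setC ?Hp -?EFinB ?lee_fin //; exact: measurable_funPTI.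
Qed.

Lemma link_prob (x y : vertex) : link x y ->
  (sigma%:E <= P (X (inl (mk_edge x y)) @^-1` [set true]))%E.
Proof.
move=> lxy; have ve := val_mk_edge (link_admissible lxy).
case: model => _ Hv Hh _; case: lxy => [[i /andP[i0 iL] [Qi dx Ey]]|[Ex dy]].
  rewrite /= (Hh _ i i0) ?iL ?lee_fin ?sigma_q // ve.
  exists x.1, y.1, x.2; split=> //; rewrite {2}Ey.
  by case: (x) (y) => [? ?] [].
rewrite /= Hv ?lee_fin // ve; exists x.1, x.2, y.2; split=> //; rewrite {2}Ex.
by case: (x) (y) => [? ?] [].
Qed.

(** A route prescribes nine coordinates: five open edges and four labels. *)
Lemma prob_hit dd s j a b w :
  sigma ^+ 9 <= prob X (fun c => hit (label c) (opened c) dd s j a b w).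
Proof.
have /andP[s0 s1] := sigma01.
pose r := map embed (route dd s j a b).
pose B (i : edges + vertex) : set bool :=
  match i with inl _ => [set true] | inr v => [set nth false w (index v r)] end.
pose coords : seq (edges + vertex) :=
  [seq inl (mk_edge (embed e.1) (embed e.2)) | e <- route_edges dd s j a b] ++
  [seq inr x | x <- r].
apply: le_trans (@cylinder_ge _ _ _ _ _ X X_independent coords B _ s0 s1 _) _.
- move=> i; rewrite mem_cat => /orP[/mapP[e /route_link le ->]|/mapP[v _ ->]].
    exact: link_prob le.
  exact: label_prob.
apply: fine_le.
- by rewrite fin_num_measure //; apply: measurable_cylinder.
- rewrite fin_num_measure //; apply: measurable_event (hit_depends _ _ _ _ _ _).
apply: le_measure; rewrite ?inE.
- exact: measurable_cylinder.
- by apply: measurable_event (hit_depends _ _ _ _ _ _).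
move=> t ct; have {}ct i : i \in coords -> B i (X i t).
  exact: in_cylinder ct.
rewrite /event /= hitE; apply/andP; split.
  apply/allP => e er; rewrite /opened (link_admissible (route_link er)) /=.
  apply: (ct (inl (mk_edge (embed e.1) (embed e.2)))).
  by rewrite mem_cat; apply/orP; left; apply/mapP; exists e.
apply/eqP; apply: (@eq_from_nth _ false); first by rewrite size_map size_tuple.
move=> i; rewrite size_map => i4.
rewrite (nth_map (entry J s a)) // /label.
set v := embed _; have vr : v \in r by apply/map_f/mem_nth.
have -> : X (inr v) t = nth false w (index v r).
  apply: (ct (inr v)); rewrite mem_cat; apply/orP; right.
  by apply/mapP; exists v.
congr nth; have -> : v = nth origin r i by rewrite (nth_map (entry J s a)).
rewrite index_uniq ?size_map // map_inj_uniq;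
  [exact: uniq_route|exact: embed_inj].
Qed.

(** Sum over the defects: the candidates, respectively the lanes, are independent
   trials, each successful with probability at least [sigma ^+ 9]. *)
Lemma prob_bad_site s (rho := 1 - sigma ^+ 9 : R) :
  prob X (fun c => bad_site (label c) (opened c) s) <=
  2 * rho ^+ #|A| + #|{: bool * A * A * 4.-tuple bool}|%:R * rho ^+ #|J|.
Proof.
have /andP[s0 s1] := sigma01.
have s91 : sigma ^+ 9 <= 1 by rewrite exprn_ile1.
apply: le_trans (prob_exists X (fails_depends s)) _.
rewrite big_sumType /=; apply: lerD.
  have -> : 2 * rho ^+ #|A| = \sum_(y : bool) rho ^+ #|A|.
    by rewrite sumr_const card_bool mulr_natl.
  apply: ler_sum => y _.
  apply: (@prob_all_fail _ _ _ P _ X X_independent A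
    (fun a => [set inr (embed (entry J s a))])) => //.
  - by move=> a; apply: label_depends.
  - by move=> a a' i -> /inr_embed_inj [].
  - move=> a; apply: (@le_trans _ _ sigma).
      by rewrite -[leRHS]expr1 ler_wiXn2l.
    rewrite -lee_fin /prob fineK; last first.
      rewrite fin_num_measure //.
      by apply: measurable_event (label_depends _ _ _).
    have -> : event X (fun c => label c (entry J s a) == y) =
        X (inr (embed (entry J s a))) @^-1` [set y].
      by apply/seteqP; split=> t /eqP.
    exact: label_prob.
rewrite mulr_natl -sumr_const; apply: ler_sum => -[[[dd a] b] w] _.
apply: (@prob_all_fail _ _ _ P _ X X_independent J
    (fun j => lane_coords (dd, s, j))) => //.
- by move=> j; apply: hit_depends.
- by move=> j j' i H1 H2; case: (lane_coords_disjoint H1 H2).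
- by move=> j; apply: prob_hit.
Qed.

Lemma all_words_prob (x : R) (rho := 1 - sigma ^+ 9 : R) : 162 * x <= 1 ->
  2 * rho ^+ #|A| + #|{: bool * A * A * 4.-tuple bool}|%:R * rho ^+ #|J| <= x ->
  ((1 - 2 * x)%:E <=
    P [set t | words_seen L (omega ^~ t) (eta ^~ t) = [set: word]])%E.
Proof.
move=> x_small bad_small.
have [mA PA] := prob_all_boxes_good X_independent
  (bad := fun c => bad_site (label c) (opened c)) site_coords_disjoint
  bad_site_depends (fun s => le_trans (prob_bad_site s) bad_small) x_small.
apply: le_trans PA _; apply: le_measure; rewrite ?inE //.
  exact: measurable_all_words.
move=> t good; apply/all_words_seenP => ws; apply: seen_prefix_of_good_boxes => k.
have -> : (fun i => match i with inl e => omega e t | inr v => eta v t end) = 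
  (fun i => X i t) by apply/funext => -[].
exact: good.
Qed.

End Probability.
End Embedding.

Lemma limsup_infinitely_often (R : realType) (q : nat -> R) :
  (0 < limn_esup (fun i => (q i)%:E))%E ->
  exists2 delta : R, 0 < delta & forall N, exists2 i, (N < i)%N & delta <= q i.
Proof.
move=> l0; have [delta /andP[d0 dl]] :
    exists delta : R, (0 < delta%:E < limn_esup (fun i => (q i)%:E))%E.
  case: (limn_esup _) l0 => [r| |] //.
    rewrite lte_fin => r0; exists (r / 2); rewrite !lte_fin.
    by apply/andP; split; lra.
  by move=> _; exists 1; rewrite lte_fin ltr01 ltry.
exists delta; first by rewrite -lte_fin.
move=> N; apply: contrapT => nex.
suff : (limn_esup (fun i => (q i)%:E) <= delta%:E)%E by rewrite leNgt dl.
apply: (@le_trans _ _ (ereal_sup ((fun i => (q i)%:E) @` [set i | (N < i)%N]))).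
  by apply: ereal_inf_lbound; exists [set i | (N < i)%N] => //; exists N.+1.
apply: ge_ereal_sup => _ [i /= Ni <-]; rewrite lee_fin leNgt; apply/negP.
by move=> /ltW dq; apply: nex; exists i.
Qed.

Lemma geometric_small (R : realType) (r C e : R) :
  0 <= r < 1 -> 0 <= C -> 0 < e -> exists n, C * r ^+ n <= e.
Proof.
move=> /andP[r0 r1] C0 e0.
have /cvgr0_norm_le : C * r ^+ n @[n --> \oo] --> 0.
  by apply: cvg_geometric; rewrite ger0_norm.
move=> /(_ e e0)[n _ /(_ n (leqnn n))] /=.
by rewrite ger0_norm ?mulr_ge0 ?exprn_ge0 //; exists n.
Qed.

Theorem theorem2 (R : realType) (q : nat -> R)
    (q01 : forall i : nat, (1 <= i)%N -> 0 <= q i <= 1)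
    (limsup_q : (0 < limn_esup (fun i => (q i)%:E))%E)
    (p : R) (p01 : 0 < p < 1)
    (eps : R) (eps01 : 0 < eps <= 1)
    (alpha : R) (alpha_gt0 : 0 < alpha) :
  exists K : nat, (1 <= K)%N /\
    forall (d : measure_display) (T : measurableType d) (P : probability T R)
      (omega : edges -> {RV P >-> bool}) (eta : vertex -> {RV P >-> bool}),
      percolation_model K p eps q omega eta ->
      ((1 - alpha)%:E
         < P [set t | words_seen K (omega ^~ t) (eta ^~ t) = [set: word]])%E.
Proof.
have [/andP[p0 p1] /andP[e0 e1]] := (p01, eps01).
have [delta d0 often] := limsup_infinitely_often limsup_q.
pose sigma := Num.min (Num.min delta eps) (Num.min p (1 - p)).
have s0 : 0 < sigma by rewrite !lt_min d0 e0 p0 subr_gt0.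
have [sd se sp s1p] :
    [/\ sigma <= delta, sigma <= eps, sigma <= p & sigma <= 1 - p].
  by rewrite /sigma !ge_min !lexx ?orbT.
have s1 : sigma <= 1 by apply: le_trans se e1.
pose rho : R := 1 - sigma ^+ 9.
have rho01 : 0 <= rho < 1.
  by rewrite subr_ge0 exprn_ile1 ?(ltW s0) //= ltrBlDr ltrDl exprn_gt0.
(* [162 * x <= 1] starts the recursion over scales; [2 * x < alpha] concludes. *)
pose x := Num.min (162^-1) (alpha / 4).
have x0 : 0 < x by rewrite lt_min; apply/andP; split; lra.
have x2 : 0 < x / 2 by lra.
(* The candidates come first: the number of defects to exclude by the lanes is
   quadratic in the number of candidates. *)
have [m Hm] := geometric_small rho01 (ler0n R 2) x2.
pose A : finType := 'I_m.+1.
have [n Hn] := geometric_small rho01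
  (ler0n R #|{: bool * A * A * 4.-tuple bool}|) x2.
pose J : finType := 'I_n.
pose Q i := delta <= q i.
have [f [l [L [f_good l_good L_good off_inj off_lt]]]] :=
  @spread_lengths Q A (bool * bool * J)%type often.
exists L; split; first exact: leq_ltn_trans (off_lt (None, None)).
move=> d T P omega eta model.
have sigma01 : 0 <= sigma <= 1 by rewrite (ltW s0).
have xalpha : x <= alpha / 4 by rewrite ge_min lexx orbT.
have x162 : x <= 162^-1 by rewrite ge_min lexx.
apply: (@lt_le_trans _ _ (1 - 2 * x)%:E); first by rewrite lte_fin; lra.
apply: (all_words_prob ord0 f_good l_good L_good off_inj off_lt model sigma01
  (fun i Qi => le_trans sd Qi) se sp s1p).
  lra.
have Hm' : 2 * rho ^+ #|A| <= x / 2.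
  apply: le_trans Hm; rewrite ler_pM2l // card_ord exprS ler_piMl ?exprn_ge0 //;
    by case/andP: rho01 => // ? /ltW.
rewrite -/rho (card_ord n); lra.
Qed.
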